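(* Let $j$ be a positive integer, $|q|<1$ and $w\in\mathbb{C}$. For positive integers $n$ and nonnegative integers $m$, let $\overline{P}_j(n,m)$ be the number of overpartitions of $n$ in which exactly $m$ positive integers less than the largest part, but greater than or equal to $j$, are missing. Then \[ \sum_{n=1}^{\infty}\sum_{m=0}^{\infty} \overline{P}_j(n,m)w^mq^n=\frac{2w^{-j}(-q;q)_{j-1}}{\left(\frac{w-2}{w};q\right)_j}\left(\frac{((w-2)q;q)_{\infty}}{(wq;q)_{\infty}}-\sum_{\ell=0}^{j-1}\frac{\left(\frac{w-2}{w};q\right)_{\ell}}{(q;q)_\ell}(wq)^\ell\right). \]
   Context: An overpartition of $n$ is a partition of $n$ in which the first occurrence of any integer may be overlined. The largest part of an overpartition is the largest integer occurring in it (overlined or not). An integer $i$ is missing from an overpartition if it occurs neither overlined nor non-overlined; the missing integers counted are positive integers less than the largest part. Notation: $(a;q)_0=1$, $(a;q)_n=(1-a)(1-aq)\cdots(1-aq^{n-1})$, $(a;q)_\infty=\prod_{i\ge1}(1-aq^{i-1})$.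
   Formalization: Only overpartitions with largest part at least j are counted (otherwise the identity fails for j ≥ 2, e.g. j = 2, n = 1); |wq| < 1 is assumed for convergence, and w ≠ 0 and ((w-2)/w;q)_j ≠ 0 so that the right-hand side is defined. *)

(* Defs.v *)
From HB Require Import structures.
From mathcomp Require Import all_boot all_order all_algebra.
From mathcomp Require Import complex.
From mathcomp Require Import all_classical all_reals all_analysis.

Set Implicit Arguments.
Unset Strict Implicit.
Unset Printing Implicit Defensive.

Import Order.TTheory GRing.Theory Num.Theory.
Import numFieldNormedType.Exports.

Local Open Scope classical_set_scope.
Local Open Scope ring_scope.

(* A part is a pair (size, overlined?).  Parts are listed in weakly decreasing
   order of size, so that equal sizes are adjacent and an overlined part is the
   first occurrence of its size iff it is strictly smaller than the part
   preceding it. *)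
Definition may_follow (x y : nat * bool) : bool :=
  if y.2 then (y.1 < x.1)%N else (y.1 <= x.1)%N.

Definition is_overpartition (n : nat) (s : seq (nat * bool)) : bool :=
  [&& sorted may_follow s, all (fun x => 0 < x.1)%N s & sumn (unzip1 s) == n].

Definition largest_part (s : seq (nat * bool)) : nat := (\max_(x <- s) x.1)%N.

Definition missing_from (j : nat) (s : seq (nat * bool)) : nat :=
  count (fun i => i \notin unzip1 s) (index_iota j (largest_part s)).

(* An overpartition of n has at most n parts, each of size at most n, so
   n.-bseq ('I_n.+1 * bool) contains all of them.  Only overpartitions whose
   largest part is at least j are counted: when it is smaller than j there are
   no integers from j up to the largest part to speak of.  Counting these
   overpartitions too, with m = 0, would for j > 1 add terms of order less than
   j in q to the generating function. *)
Definition Pbar (j n m : nat) : nat :=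
  #|[pred s : n.-bseq ('I_n.+1 * bool) |
      let t := [seq (nat_of_ord x.1, x.2) | x <- s] in
      [&& is_overpartition n t, (j <= largest_part t)%N &
          missing_from j t == m]]|.

(* The norm topology on R[i] is the one carried by its alias R[i]^o. *)
Section Series.
Variable R : realType.
Implicit Types (a q : R[i]).

Definition qpoch a q (n : nat) : R[i] := \prod_(i < n) (1 - a * q ^+ i).

Definition qpoch_inf a q : R[i] :=
  lim ((qpoch a q : nat -> R[i]^o) @ \oo).

(* Both the inner series over m and the outer series over n converge, and the
   iterated sum is l. *)
Definition is_double_series (u : nat -> nat -> R[i]) (l : R[i]) : Prop :=
  exists2 v : nat -> R[i]^o,
    forall n, series (u n : nat -> R[i]^o) @ \oo --> v n &
    series v @ \oo --> (l : R[i]^o).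

End Series.

(* Main.v *)
(* Sort the overpartitions with largest part N >= j by N.  The sizes i < N vary
   independently: i < j contributes (1 + q^i) / (1 - q^i), i >= j contributes
   w + 2 q^i / (1 - q^i) = w (1 - a q^i) / (1 - q^i) with a = (w - 2) / w, and N
   contributes 2 q^N / (1 - q^N).  The product of these factors is a constant
   times (a; q)_N / (q; q)_N (w q)^N, so summing over N >= j leaves the
   q-binomial series at z = w q minus its first j terms.  The q-binomial theorem
   follows from (1 - z) F(z) = (1 - a z) F(q z) by iteration, and the sums over n
   and N are interchanged because the same series converge at |w| and |q|. *)

Require Import Defs.
From HB Require Import structures.
From mathcomp Require Import all_boot all_order all_algebra.
From mathcomp Require Import complex.
From mathcomp Require Import all_classical all_reals all_analysis.
From mathcomp Require Import ring zify.

Set Implicit Arguments.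
Unset Strict Implicit.
Unset Printing Implicit Defensive.

Import Order.TTheory GRing.Theory Num.Theory.
Import numFieldNormedType.Exports.

Local Open Scope ring_scope.

(** * Limits and absolutely bounded sums *)

(* The topology of [K^o] is sealed in an inductive predicate: on a concrete
   field such as [R[i]], applying the library's limit lemmas directly makes
   unification diverge. *)
Variant seq_cvg {K : numFieldType} (f : nat -> K) (l : K) : Prop :=
  SeqCvg of ((f : nat -> K^o) @ \oo --> (l : K^o))%classic.
Local Notation "f ~> l" := (seq_cvg f l) (at level 70).

Section SeqLimits.
Context {K : numFieldType}.
Implicit Types (f g : nat -> K) (a b c : K).

Lemma cvg_seq_cst c : (fun=> c) ~> c.
Proof. by split; exact: cvg_cst. Qed.

Lemma cvg_seqD f g a b : f ~> a -> g ~> b -> (fun n => f n + g n) ~> (a + b).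
Proof. by move=> [fa] [gb]; split; exact: (@cvgD _ K^o). Qed.

Lemma cvg_seqB f g a b : f ~> a -> g ~> b -> (fun n => f n - g n) ~> (a - b).
Proof. by move=> [fa] [gb]; split; exact: (@cvgB _ K^o). Qed.

Lemma cvg_seqM f g a b : f ~> a -> g ~> b -> (fun n => f n * g n) ~> (a * b).
Proof. by move=> [fa] [gb]; split; exact: cvgM. Qed.

Lemma cvg_seqMl c f a : f ~> a -> (fun n => c * f n) ~> (c * a).
Proof. by move=> [fa]; split; exact: cvgMl_tmp. Qed.

Lemma cvg_seqMr c f a : f ~> a -> (fun n => f n * c) ~> (a * c).
Proof. by move=> [fa]; split; exact: cvgMr_tmp. Qed.

Lemma cvg_seqV f a : a != 0 -> f ~> a -> (fun n => (f n)^-1) ~> a^-1.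
Proof. by move=> a0 [fa]; split; exact: cvgV. Qed.

Lemma cvg_seq_unique f a b : f ~> a -> f ~> b -> a = b.
Proof. by move=> [fa] [fb]; apply: (@norm_cvg_unique _ K^o _ _ _ _ fa fb). Qed.

Lemma seq_cvg_lim f a : f ~> a -> lim ((f : nat -> K^o) @ \oo)%classic = a.
Proof. by move=> [fa]; exact: norm_cvg_lim. Qed.

Lemma cvg_series0 f a : series f ~> a -> f ~> 0.
Proof.
by move=> [fa]; split; apply: (@cvg_series_cvg_0 _ K^o); apply/cvg_ex; exists a.
Qed.

Lemma cvg_seq_near N f g a :
  f ~> a -> (forall n, (N <= n)%N -> f n = g n) -> g ~> a.
Proof.
move=> [fa] fg; split; move: fa; apply: cvg_trans; apply: near_eq_cvg.
by exists N => // n /= Nn; rewrite fg.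
Qed.

Lemma cvg_seq_dist f a : f ~> a <->
  forall e, 0 < e -> exists N, forall n, (N <= n)%N -> `|a - f n| <= e.
Proof.
split=> [[/cvgrPdist_le fa] e /fa[N _ HN]|fa]; first by exists N => n /HN.
by split; apply/cvgrPdist_le => e /fa[N HN]; exists N => // n /HN.
Qed.

Lemma cvg_seq_sum (f : nat -> nat -> K) (l : nat -> K) N :
  (forall k, f k ~> l k) ->
  (fun n => \sum_(0 <= k < N) f k n) ~> (\sum_(0 <= k < N) l k).
Proof.
move=> fl; elim: N => [|N IH].
  rewrite big_geq //; apply: (cvg_seq_near (N := 0) (cvg_seq_cst _)) => n _.
  by rewrite big_geq.
rewrite big_nat_recr //=.
apply: (cvg_seq_near (N := 0) (cvg_seqD IH (fl N))) => n _.
by rewrite big_nat_recr.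
Qed.

End SeqLimits.

(** * Series with bounded absolute partial sums *)

Section AbsSums.
Context {K : numFieldType}.
Implicit Types (u v : nat -> K) (s a c : K).

(** The bound [a] is carried along explicitly because interchanging two summations requires the
    bounds of the rows to be summable. It need not be the least bound. *)
Definition abs_sums u s a : Prop :=
  series u ~> s /\
  forall n, \sum_(0 <= i < n) `|u i| <= a.

Lemma abs_sums_ext u v s a : u =1 v -> abs_sums u s a -> abs_sums v s a.
Proof. by move=> /funext ->. Qed.

Lemma abs_sums_bound_ge0 u s a : abs_sums u s a -> 0 <= a.
Proof. by case=> _ /(_ 0); rewrite big_geq. Qed.

Lemma abs_sums_unique u s s' a a' :
  abs_sums u s a -> abs_sums u s' a' -> s = s'.
Proof. by move=> [us _] [us' _]; exact: cvg_seq_unique us us'. Qed.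

Lemma abs_sumsZ c u s a :
  abs_sums u s a -> abs_sums (fun n => c * u n) (c * s) (`|c| * a).
Proof.
move=> [us ua]; split=> [|n].
  apply: (cvg_seq_near (N := 0) (cvg_seqMl c us)) => n _.
  by rewrite /series /= mulr_sumr.
under eq_bigr do rewrite normrM.
by rewrite -mulr_sumr ler_wpM2l.
Qed.

Lemma abs_sumsD u v s t a b : abs_sums u s a -> abs_sums v t b ->
  abs_sums (fun n => u n + v n) (s + t) (a + b).
Proof.
move=> [us ua] [vt vb]; split=> [|n].
  apply: (cvg_seq_near (N := 0) (cvg_seqD us vt)) => n _.
  by rewrite /series /= big_split.
apply: le_trans (lerD (ua n) (vb n)).
by rewrite -big_split ler_sum // => i _; exact: ler_normD.
Qed.

Lemma abs_sums0 : abs_sums (fun=> 0) 0 0.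
Proof.
split=> [|n]; last by rewrite big1 // => i _; rewrite normr0.
by apply: (cvg_seq_near (N := 0) (cvg_seq_cst _)) => n _; rewrite /series /= big1.
Qed.

Lemma abs_sums_delta : abs_sums (fun n => (n == 0)%:R) 1 1.
Proof.
split=> [|[|n]]; last 2 first.
- by rewrite big_geq.
- by rewrite big_nat_recl //= big1 ?normr1 ?addr0 // => i _; rewrite normr0.
apply: (cvg_seq_near (N := 1) (cvg_seq_cst _)) => -[//|n] _.
by rewrite /series /= big_nat_recl //= big1 ?addr0.
Qed.

Lemma abs_sums_shift d u s a : abs_sums u s a ->
  abs_sums (fun n => if (d <= n)%N then u (n - d)%N else 0) s a.
Proof.
have shiftE (V : nmodType) (f : nat -> V) n :
    \sum_(0 <= i < n) (if (d <= i)%N then f (i - d)%N else 0) =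
    \sum_(0 <= i < n - d) f i.
  have [nd|dn] := leqP n d.
    rewrite (_ : n - d = 0)%N; last by apply/eqP; rewrite subn_eq0.
    rewrite [RHS]big_geq // big_nat big1 // => i /andP[_ ilt].
    by rewrite leqNgt (leq_trans ilt nd).
  rewrite (big_cat_nat (n := d)) ?(ltnW dn) //= [X in X + _]big_nat big1; last first.
    by move=> i /andP[_ ilt]; rewrite leqNgt ilt.
  rewrite add0r -{1}[d]add0n big_addn; apply: eq_bigr => i _.
  by rewrite leq_addl addnK.
move=> [/cvg_seq_dist us ua]; split=> [|n].
  apply/cvg_seq_dist => e /us[N HN]; exists (N + d)%N => n Nn.
  rewrite /series /= shiftE; apply: HN.
  by rewrite leq_subRL ?(leq_trans _ Nn) ?leq_addl // addnC.
rewrite (eq_bigr (fun i => if (d <= i)%N then `|u (i - d)%N| else 0)).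
  by rewrite (shiftE _ (fun i => `|u i|)).
by move=> i _; case: ifP => // _; rewrite normr0.
Qed.

Lemma abs_sums_partial_le u s a n :
  abs_sums u s a -> `|\sum_(0 <= i < n) u i| <= a.
Proof. by move=> [_ /(_ n)]; apply: le_trans; exact: ler_norm_sum. Qed.

Lemma abs_sums_le u s a : abs_sums u s a -> `|s| <= a.
Proof.
move=> us; have [/cvg_seq_dist ucvg _] := us.
apply/ler_addgt0Pr => e /ucvg[N /(_ N (leqnn N)) HN].
rewrite -(subrK (series u N) s).
rewrite (le_trans (ler_normD _ _)) // addrC lerD //.
exact: abs_sums_partial_le us.
Qed.

End AbsSums.

(** * Absolute convergence and interchange of sums over the complex numbers *)

Section ComplexSums.
Context {R : realType}.
Local Notation C := R[i].
Implicit Types (u v : nat -> C) (s a c : C).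

(** Nonnegative elements of [R[i]] are real, so the real parts form a series with bounded, monotone
    partial sums, whose tails tend to zero. *)
Lemma nneg_tail_le (u : nat -> C) (A e : C) : (forall n, 0 <= u n) ->
  (forall n, \sum_(0 <= i < n) u i <= A) -> 0 < e ->
  exists N, forall n, \sum_(N <= i < n) u i <= e.
Proof.
move=> u0 uA e0.
have uE n : u n = (complex.Re (u n))%:C%C.
  by rewrite RRe_real // ger0_real.
have sE m n : \sum_(m <= i < n) u i = (\sum_(m <= i < n) complex.Re (u i))%:C%C.
  by rewrite rmorph_sum; apply: eq_bigr => i _; exact: uE.
have A0 : 0 <= A by have := uA 0; rewrite big_geq.
pose v n := complex.Re (u n).
have v0 n : 0 <= v n by rewrite -ler0c -uE.
have vcvg : cvgn (series v).
  apply: nondecreasing_is_cvgn; first exact: nondecreasing_series.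
  exists (complex.Re A) => _ [n _ <-].
  by rewrite /series /= -lecR -sE RRe_real // ger0_real.
have /cvgrPdist_le /(_ (complex.Re e)) [|N _ HN] := vcvg.
  by rewrite -ltcR RRe_real // gtr0_real.
exists N => n; have [nN|Nn] := leqP n N; first by rewrite big_geq // ltW.
rewrite sE -(@RRe_real _ e) ?gtr0_real // lecR.
have := HN N (leqnn N); apply: le_trans.
rewrite -(sub_series_geq v (ltnW Nn)) ger0_norm.
  by rewrite lerD2r; apply: nondecreasing_cvgn_le => //; exact: nondecreasing_series.
rewrite subr_ge0; apply: nondecreasing_cvgn_le => //; exact: nondecreasing_series.
Qed.

(** Completeness comes from [R]: real and imaginary parts are dominated by the modulus, so both of
    their series converge absolutely. *)
Lemma abs_bounded_sums (u : nat -> C) a :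
  (forall n, \sum_(0 <= i < n) `|u i| <= a) -> exists s, abs_sums u s a.
Proof.
move=> ua.
have cvg_part (f : {additive C -> R}) :
    (forall x, (`|f x|)%:C%C <= `|x|) -> cvgn (series (f \o u)).
  move=> fle; apply: normed_cvg.
  apply: nondecreasing_is_cvgn.
    by apply: nondecreasing_series => *; exact: normr_ge0.
  exists (complex.Re a) => _ [n _ <-].
  rewrite -lecR RRe_real; last first.
    by rewrite ger0_real //; have := ua 0; rewrite big_geq.
  apply: le_trans (ua n); rewrite rmorph_sum; apply: ler_sum => i _; exact: fle.
have [lx cx] : exists l : R,
    (series ((@complex.Re R) \o u : nat -> R) @ \oo --> l)%classic.
  by apply/cvg_ex; apply: cvg_part => x; exact: normc_ge_Re.
have [ly cy] : exists l : R,
    (series ((@complex.Im R) \o u : nat -> R) @ \oo --> l)%classic.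
  apply/cvg_ex; apply: cvg_part => x.
  by case: x => x y; rewrite normc_def /= lecR -sqrtr_sqr ler_wsqrtr // lerDr sqr_ge0.
exists (Complex lx ly); split=> //.
apply/cvg_seq_dist => e e0.
have e2 : 0 < complex.Re e / 2.
  by move: e0; rewrite ltcE => /andP[_ e0]; rewrite divr_gt0.
have /cvg_seq_dist/(_ _ e2)[M HM] := SeqCvg cx.
have /cvg_seq_dist/(_ _ e2)[N HN] := SeqCvg cy.
exists (maxn M N) => n; rewrite geq_max => /andP[/HM hx /HN hy].
have -> : e = (complex.Re e / 2)%:C%C + (complex.Re e / 2)%:C%C.
  by rewrite -rmorphD -splitr /= RRe_real // gtr0_real.
have sE : series u n =
    Complex (series ((@complex.Re R) \o u) n) (series ((@complex.Im R) \o u) n).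
  rewrite /series /=.
  by apply/eqP; rewrite eq_complex /= !raddf_sum !eqxx.
rewrite sE -[_ - _]/(Complex _ _) [X in `|X|]complexE /=.
rewrite (le_trans (ler_normD _ _)) // normrM normCi mul1r.
have nR (x : R) : `|x%:C%C| = (`|x|)%:C%C :> C.
  by rewrite normc_def /= expr0n /= addr0 sqrtr_sqr.
rewrite !nR; apply: lerD; rewrite lecR; [exact: hx|exact: hy].
Qed.

(** Interchange of summations for a triangular array. Its zeros turn triangular partial sums into
    square ones. Finitely many rows are close to their limits, and each later row [k] is off by at
    most [a k + a k], a term of a small tail. *)
Lemma abs_sums_triangular (f : nat -> nat -> C) (s a : nat -> C) S A :
  (forall k, abs_sums (f k) (s k) (a k)) ->
  (forall k n, (n < k)%N -> f k n = 0) ->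
  series s ~> S ->
  (forall n, \sum_(0 <= k < n) a k <= A) ->
  abs_sums (fun n => \sum_(0 <= k < n.+1) f k n) S A.
Proof.
move=> fs f0 sS aA.
have square (V : nmodType) (h : C -> V) n : h 0 = 0 ->
    \sum_(0 <= i < n) \sum_(0 <= k < i.+1) h (f k i) =
    \sum_(0 <= k < n) \sum_(0 <= i < n) h (f k i).
  move=> h0; rewrite [RHS]exchange_big_nat /=; apply: eq_big_nat => i /andP[_ iln].
  rewrite [RHS](big_cat_nat (n := i.+1)) //=.
  rewrite [X in _ + X]big_nat [X in _ + X]big1 ?addr0 //.
  by move=> k /andP[ik _]; rewrite f0.
have a0 k : 0 <= a k by exact: abs_sums_bound_ge0 (fs k).
split; last first.
  move=> n; apply: le_trans (aA n).
  apply: (@le_trans _ _ (\sum_(0 <= i < n) \sum_(0 <= k < i.+1) `|f k i|)).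
    by apply: ler_sum => i _; exact: ler_norm_sum.
  rewrite (square _ (fun x => `|x|)) ?normr0 //.
  by apply: ler_sum => k _; have [_] := fs k; apply.
apply/cvg_seq_dist => e e0.
(* One quarter for each of the two limits, and two quarters for the tail rows, which cost [a k]
   twice. *)
have e4 : 0 < e / 4 by rewrite divr_gt0.
have [N HN] := nneg_tail_le a0 aA e4.
have /cvg_seq_dist/(_ _ e4)[M1 HM1] := sS.
have headS := cvg_seq_sum N (fun k => (fs k).1).
have /cvg_seq_dist/(_ _ e4)[M2 HM2] := headS.
exists (maxn N (maxn M1 M2)) => M; rewrite !geq_max => /and3P[NM /HM1 h1 /HM2 h2].
rewrite {1}/series /= (square _ id) // (big_cat_nat (leq0n N) NM) //=.
have -> : S - (\sum_(0 <= k < N) \sum_(0 <= i < M) f k i +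
     \sum_(N <= k < M) \sum_(0 <= i < M) f k i) =
   S - series s M +
   (\sum_(0 <= k < N) s k - \sum_(0 <= k < N) series (f k) M) +
   \sum_(N <= k < M) (s k - series (f k) M).
  rewrite /series /= sumrB (big_cat_nat (leq0n N) NM (F := s)) //=; ring.
rewrite (le_trans (ler_normD _ _)) //.
have -> : e = e / 4 + e / 4 + (e / 4 + e / 4) by field.
apply: lerD; first by rewrite (le_trans (ler_normD _ _)) // lerD.
rewrite (le_trans (ler_norm_sum _ _ _)) //.
apply: (@le_trans _ _ (\sum_(N <= k < M) (a k + a k))); last by rewrite big_split lerD.
apply: ler_sum => k _; rewrite (le_trans (ler_normB _ _)) //.
exact: lerD (abs_sums_le (fs k)) (abs_sums_partial_le _ (fs k)).
Qed.

Lemma ratio_test (u rho : nat -> C) l :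
  (forall n, u n.+1 = rho n * u n) ->
  rho ~> l -> `|l| < 1 ->
  exists a, forall n, \sum_(0 <= i < n) `|u i| <= a.
Proof.
move=> uS rhol l1.
pose r := (`|l| + 1) / 2.
have lr : `|l| < r by rewrite /r midf_lt.
have r1 : r < 1 by rewrite /r midf_lt.
have /cvg_seq_dist/(_ (r - `|l|)) [|N HN] := rhol; first by rewrite subr_gt0.
have r1' : 0 < 1 - r by rewrite subr_gt0.
(* Adding the geometric majorant of the remaining terms, with [r] halfway between [|l|] and 1, makes
   [b] bounded by its value at [N] from there on. *)
pose b n := \sum_(0 <= i < n) `|u i| + `|u n| / (1 - r).
have b_le m : b (N + m)%N <= b N.
  elim: m => [|m IH]; first by rewrite addn0.
  apply: le_trans IH; rewrite addnS /b big_nat_recr //= -addrA lerD2l.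
  have rho_r : `|rho (N + m)%N| <= r.
    have := HN _ (leq_addr m N); rewrite distrC -(lerD2r `|l|) subrK.
    by apply: le_trans; rewrite -{1}(subrK l (rho _)) ler_normD.
  rewrite uS normrM.
  have -> : `|u (N + m)%N| / (1 - r) = `|u (N + m)%N| + r * `|u (N + m)%N| / (1 - r).
    by field; rewrite gt_eqF.
  by rewrite lerD2l ler_pM2r ?invr_gt0 // ler_wpM2r.
exists (b N) => n.
apply: (@le_trans _ _ (\sum_(0 <= i < N + n) `|u i|)).
  rewrite addnC (big_cat_nat (n := n) (p := n + N)) ?leq_addr //= lerDl.
  by apply: sumr_ge0 => i _.
by apply: le_trans (b_le n); rewrite lerDl divr_ge0 // ltW.
Qed.

Lemma geometric_sum_le (x : C) n : 0 <= x -> x < 1 ->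
  \sum_(0 <= i < n) x ^+ i <= (1 - x)^-1.
Proof.
move=> x0 x1; have h : 0 < 1 - x by rewrite subr_gt0.
rewrite -[_^-1]mul1r ler_pdivlMr //.
have -> : (\sum_(0 <= i < n) x ^+ i) * (1 - x) = 1 - x ^+ n.
  elim: n => [|m IH]; first by rewrite big_geq // mul0r expr0 subrr.
  by rewrite big_nat_recr //= mulrDl IH exprS; ring.
by rewrite gerBl exprn_ge0.
Qed.

Lemma cvg_geometric0 (x : C) : `|x| < 1 ->
  (fun n => x ^+ n) ~> (0 : C).
Proof.
move=> x1; have [|s [xs _]] := @abs_bounded_sums (fun n => x ^+ n) (1 - `|x|)^-1.
  move=> n; under eq_bigr do rewrite normrX.
  exact: geometric_sum_le.
exact: cvg_series0 xs.
Qed.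

Lemma abs_sums_geometric (x : C) : `|x| < 1 ->
  abs_sums (fun n => x ^+ n) (1 - x)^-1 (1 - `|x|)^-1.
Proof.
move=> x1; split; last first.
  by move=> n; under eq_bigr do rewrite normrX; exact: geometric_sum_le.
have x10 : 1 - x != 0.
  by rewrite subr_eq0; apply: contraTneq x1 => <-; rewrite normr1 ltxx.
rewrite (_ : series _ = fun n => (1 - x ^+ n) / (1 - x)).
  have := cvg_seqMr (1 - x)^-1 (cvg_seqB (cvg_seq_cst 1) (cvg_geometric0 x1)).
  by rewrite subr0 mul1r.
apply/funext; elim => [|n IH]; first by rewrite /series /= big_geq // expr0 subrr mul0r.
rewrite /series /= big_nat_recr //= -/(series _ n).
by move: IH; rewrite /series /= => ->; rewrite exprS; field.
Qed.

End ComplexSums.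

(** * The q-binomial theorem *)

Section QPochhammer.
Context {R : realType}.
Local Notation C := R[i].

Lemma qpochS (a q : C) n : qpoch a q n.+1 = qpoch a q n * (1 - a * q ^+ n).
Proof. by rewrite /qpoch big_ord_recr. Qed.

Lemma qpoch_0l (q : C) n : qpoch 0 q n = 1.
Proof. by rewrite /qpoch big1 // => i _; rewrite mul0r subr0. Qed.

Lemma one_sub_neq0 (x : C) : `|x| < 1 -> 1 - x != 0.
Proof.
by move=> x1; rewrite subr_eq0; apply: contraTneq x1 => <-; rewrite normr1 ltxx.
Qed.

Lemma norm_mul_lt1 (x y : C) : `|x| < 1 -> `|y| <= 1 -> `|x * y| < 1.
Proof.
move=> x1 y1; rewrite normrM; apply: le_lt_trans x1.
by rewrite -[leRHS]mulr1 ler_wpM2l.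
Qed.

Lemma norm_expr_le1 (q : C) n : `|q| < 1 -> `|q ^+ n| <= 1.
Proof. by move=> q1; rewrite normrX exprn_ile1 // ltW. Qed.

Lemma qpoch_neq0 (a q : C) n : `|q| < 1 -> `|a| < 1 -> qpoch a q n != 0.
Proof.
move=> q1 a1; apply/prodf_neq0 => i _.
by rewrite one_sub_neq0 // norm_mul_lt1 // norm_expr_le1.
Qed.

(** The general term of the basic hypergeometric series 1phi0. *)
Definition qbinomial_term (a q z : C) n := qpoch a q n / qpoch q q n * z ^+ n.

Section QBinomial.
Variable q : C.
Hypothesis q1 : `|q| < 1.
Implicit Types a z : C.

Lemma one_subX_neq0 n : 1 - q ^+ n.+1 != 0.
Proof. by rewrite one_sub_neq0 // exprS norm_mul_lt1 // norm_expr_le1. Qed.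

Lemma qbinomial_termS a z n : qbinomial_term a q z n.+1 =
  (1 - a * q ^+ n) / (1 - q ^+ n.+1) * z * qbinomial_term a q z n.
Proof.
have := qpoch_neq0 n q1 q1; have := one_subX_neq0 n; rewrite exprS => h1 h2.
by rewrite /qbinomial_term !qpochS !exprS; field; rewrite h1 h2.
Qed.

Lemma cvg_one_subX_ratio a : (fun n => (1 - a * q ^+ n) / (1 - q ^+ n.+1)) ~> 1.
Proof.
have qn := cvg_geometric0 q1.
have cvg_fac b : (fun n => 1 - b * q ^+ n) ~> 1.
  by have := cvg_seqB (cvg_seq_cst 1) (cvg_seqMl b qn); rewrite mulr0 subr0.
have := cvg_seqM (cvg_fac a) (cvg_seqV (oner_neq0 _) (cvg_fac q)).
rewrite invr1 mulr1 => h; apply: (cvg_seq_near (N := 0) h) => n _.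
by rewrite exprS.
Qed.

(** The ratio of successive terms tends to [z]. *)
Lemma qbinomial_summable a z : `|z| < 1 ->
  exists s B, abs_sums (qbinomial_term a q z) s B.
Proof.
move=> z1.
have [|B HB] := @ratio_test _ (qbinomial_term a q z) _ z (qbinomial_termS a z) _ z1.
  by have := cvg_seqMr z (cvg_one_subX_ratio a); rewrite mul1r.
by have [s sB] := abs_bounded_sums HB; exists s, B.
Qed.

(** * Functional equation of the q-binomial series and its iteration *)

Section FunctionalEquation.
(** [F] stands for any choice of the sums; [qbinomial] takes the limit of the partial sums. *)
Variable F : C -> C -> C.
Hypothesis Fsum : forall a z, `|z| < 1 ->
  exists B, abs_sums (qbinomial_term a q z) (F a z) B.

(** Written as F(z) - F(zq) = z F(z) - a z F(zq), the identity holds term by term: both constant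
    terms vanish, and in degree n+1 it is the coefficient recurrence (1 - q^{n+1}) c_{n+1} = (1 - a
    q^n) c_n. *)
Lemma qbinomial_shift a z : `|z| < 1 ->
  (1 - z) * F a z = (1 - a * z) * F a (z * q).
Proof.
move=> z1; have zq1 : `|z * q| < 1 by rewrite norm_mul_lt1 // ltW.
have [B Fz] := Fsum a z1; have [B' Fzq] := Fsum a zq1.
have rhs := abs_sums_shift 1 (abs_sumsD (abs_sumsZ z Fz) (abs_sumsZ (- (a * z)) Fzq)).
have lhs := abs_sumsD Fz (abs_sumsZ (-1) Fzq).
have E : F a z + -1 * F a (z * q) =
  z * F a z + - (a * z) * F a (z * q).
  apply: abs_sums_unique lhs (abs_sums_ext _ rhs) => -[|n] /=.
    by rewrite /qbinomial_term !expr0 mulN1r subrr.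
  rewrite subn1 /= /qbinomial_term !qpochS !exprMn !exprS.
  have := qpoch_neq0 n q1 q1; have := one_subX_neq0 n; rewrite exprS => h1 h2.
  by field; rewrite h1 h2.
transitivity (F a z + -1 * F a (z * q) +
  F a (z * q) - z * F a z); first by ring.
by rewrite E; ring.
Qed.

Lemma qbinomial_iter a z n : `|z| < 1 ->
  qpoch z q n * F a z =
  qpoch (a * z) q n * F a (z * q ^+ n).
Proof.
move=> z1; elim: n => [|n IH]; first by rewrite /qpoch !big_ord0 expr0 mulr1.
have zn1 : `|z * q ^+ n| < 1 by rewrite norm_mul_lt1 // norm_expr_le1.
rewrite !qpochS mulrAC IH -[LHS]mulrA [F _ _ * _]mulrC (qbinomial_shift a zn1).
by rewrite exprSr !mulrA.
Qed.

(** The constant term is 1 and every later term carries a factor [q ^+ n], so the distance to 1 is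
    at most [|q ^+ n|] times the bound at [z]. *)
Lemma cvg_qbinomial1 a z : `|z| < 1 ->
  (fun n => F a (z * q ^+ n)) ~> 1.
Proof.
move=> z1; have [B Fz] := Fsum a z1.
have key n : `|F a (z * q ^+ n) - 1| <= B * `|q ^+ n|.
  have zn1 : `|z * q ^+ n| < 1 by rewrite norm_mul_lt1 // norm_expr_le1.
  have [B' Fn] := Fsum a zn1.
  (* The nonconstant terms with one factor [q ^+ n] taken out, written without a division because
     [q] may be 0. They are dominated by the terms at [z]. *)
  pose g k := if k is k'.+1 then qbinomial_term a q z k * (q ^+ n) ^+ k' else 0.
  have [|G Gs] := @abs_bounded_sums _ g B.
    move=> m; have [_ /(_ m)] := Fz; apply: le_trans; apply: ler_sum => -[|k] _ /=.
      by rewrite normr0.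
    rewrite normrM -[leRHS]mulr1 ler_wpM2l // -exprM norm_expr_le1 //.
  have Es := abs_sumsD (abs_sums_delta (K := C)) (abs_sumsZ (q ^+ n) Gs).
  have -> : F a (z * q ^+ n) = 1 + q ^+ n * G.
    apply: abs_sums_unique Fn (abs_sums_ext _ Es) => -[|k] /=.
      by rewrite mulr0 addr0 /qbinomial_term /qpoch !big_ord0 expr0 invr1 !mulr1.
    by rewrite add0r /qbinomial_term exprMn [(q ^+ n) ^+ k.+1]exprS; ring.
  by rewrite addrC addKr normrM mulrC ler_wpM2r // (abs_sums_le Gs).
have B0 := abs_sums_bound_ge0 Fz.
apply/cvg_seq_dist => e e0.
(* The added 1 keeps the denominator positive when [B] is 0. *)
have eB : 0 < e / (B + 1) by rewrite divr_gt0 // ltr_wpDl.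
have /cvg_seq_dist/(_ _ eB)[N HN] := cvg_geometric0 q1.
exists N => n /HN; rewrite sub0r normrN => h.
rewrite distrC (le_trans (key n)) // (le_trans (ler_wpM2l B0 h)) //.
rewrite mulrCA ger_pMr // ler_pdivrMr ?mul1r ?lerDl //.
by rewrite ltr_wpDl.
Qed.

(* The functional equation with [a = 0] reads
   [qpoch z q n * F 0 z = F 0 (z * q ^+ n)], and the right-hand side tends to 1. *)
Lemma qpoch_cvg_neq0 z : `|z| < 1 ->
  exists2 l, l != 0 & qpoch z q ~> l.
Proof.
move=> z1; have lim1 := cvg_qbinomial1 0 z1.
have E n : qpoch z q n * F 0 z = F 0 (z * q ^+ n).
  by rewrite (qbinomial_iter 0 n z1) mul0r qpoch_0l mul1r.
have F0 : F 0 z != 0.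
  apply/eqP => F0.
  have cst0 : (fun n => F 0 (z * q ^+ n)) ~> 0.
    apply: (cvg_seq_near (N := 0) (cvg_seq_cst _)) => n _.
    by rewrite -E F0 mulr0.
  by have /eqP := cvg_seq_unique lim1 cst0; rewrite oner_eq0.
exists (F 0 z)^-1; first by rewrite invr_eq0.
have := cvg_seqMr (F 0 z)^-1 lim1; rewrite mul1r => h.
apply: (cvg_seq_near (N := 0) h) => n _.
by rewrite -E mulfK.
Qed.

(** Let [n] grow in [qbinomial_iter]: the factor [F a (z * q ^+ n)] tends to 1. The product at
    [a * z], whose modulus is arbitrary, is shown to converge on the way. *)
Lemma qbinomial_functional a z : `|z| < 1 ->
  F a z = qpoch_inf (a * z) q / qpoch_inf z q.
Proof.
move=> z1; have [l l0 zl] := qpoch_cvg_neq0 z1.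
have lim1 := cvg_qbinomial1 a z1.
have azl : qpoch (a * z) q ~> (l * F a z).
  have := cvg_seqM (cvg_seqMr (F a z) zl) (cvg_seqV (oner_neq0 _) lim1).
  (* Within distance 1/2 of 1 the value is nonzero, so it can be cancelled for large [n]. *)
  have half : 0 < (2^-1 : C) by rewrite invr_gt0.
  have /cvg_seq_dist/(_ _ half)[N HN] := lim1.
  rewrite invr1 mulr1 => h; apply: (cvg_seq_near (N := N) h) => n Nn.
  have F0 : F a (z * q ^+ n) != 0.
    apply: contraTneq (HN n Nn) => ->.
    by rewrite subr0 normr1 lt_geF // invf_lt1 ?ltr1n // ltr0n.
  by rewrite /= qbinomial_iter // mulfK.
rewrite /qpoch_inf (seq_cvg_lim zl) (seq_cvg_lim azl) mulrAC divff //.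
by rewrite mul1r.
Qed.

End FunctionalEquation.

Theorem qbinomial a z : `|z| < 1 ->
  exists B, abs_sums (qbinomial_term a q z) (qpoch_inf (a * z) q / qpoch_inf z q) B.
Proof.
move=> z1.
pose F a z := lim ((series (qbinomial_term a q z) : nat -> C^o) @ \oo)%classic.
have Fsum b y : `|y| < 1 -> exists B, abs_sums (qbinomial_term b q y) (F b y) B.
  move=> y1; have [s [B sB]] := qbinomial_summable b y1; exists B.
  by rewrite /F (seq_cvg_lim sB.1).
by rewrite -(qbinomial_functional Fsum) //; exact: Fsum.
Qed.

End QBinomial.
End QPochhammer.

(** * Enumerating overpartitions by largest part *)

Section Enumeration.
Local Open Scope nat_scope.
Implicit Types (s t : seq (nat * bool)).

(* [k.+1] parts of size [N], the first one overlined iff [b]. *)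
Definition block N k b : seq (nat * bool) := (N, b) :: nseq k (N, false).

(** [O m] supplies the parts below [N], with sum [m]. For positive [N], bounding [k] by [n] loses
    nothing. *)
Definition with_largest N (O : nat -> seq (seq (nat * bool))) n :=
  [seq block N p.1 p.2 ++ t
     | p <- [seq (k, b) | k <- [seq k <- iota 0 n | k.+1 * N <= n],
                          b <- [:: true; false]],
       t <- O (n - p.1.+1 * N)].

(** Parts are at most [N] and their sum is [n]; the recursion asks whether the size [N] occurs. *)
Fixpoint overpartitions N n : seq (seq (nat * bool)) :=
  if N is N'.+1 then
    overpartitions N' n ++ with_largest N (overpartitions N') n
  else nseq (n == 0) [::].

Lemma may_follow_trans : transitive may_follow.
Proof. by move=> [y b] [x c] [z d]; rewrite /may_follow /=; case: b d => -[] /=; lia. Qed.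

Lemma may_follow_le x y : may_follow x y -> y.1 <= x.1.
Proof. by rewrite /may_follow; case: ifP => // _ /ltnW. Qed.

(** An overlined [N] cannot follow a part of size [N], so a run of plain copies comes next, and then
    strictly smaller parts. *)
Lemma path_blockP N b s : path may_follow (N, b) s <->
  exists k t, [/\ s = nseq k (N, false) ++ t, all (fun x => x.1 < N) t &
                  sorted may_follow t].
Proof.
split=> [|[k [t [-> tN st]]]].
  elim: s b => [|[M c] s IH] b; first by exists 0, [::].
  rewrite /= /may_follow /= => /andP[cM ps].
  have [EM|NM] := eqVneq M N.
    move: cM ps; rewrite EM; case: c; rewrite /= ?ltnn // => _ /IH[k [t [-> tN st]]].
    by exists k.+1, t.
  have MN : M < N by case: {ps} c cM => /=; lia.
  exists 0, ((M, c) :: s); split; rewrite //= MN /=.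
  apply: sub_all (order_path_min may_follow_trans ps) => x /may_follow_le /=.
  by move=> xM; exact: leq_ltn_trans xM MN.
elim: k b => [|k IH] b /=; last by rewrite IH andbT /may_follow /=.
rewrite (path_min_sorted (x := (N, b))) //.
by apply: sub_all tN => -[M c] /= MN; rewrite /may_follow /= MN (ltnW MN) if_same.
Qed.

Lemma sumn_unzip1_block N k b t :
  sumn (unzip1 (block N k b ++ t)) = k.+1 * N + sumn (unzip1 t).
Proof.
rewrite /= /unzip1 map_cat sumn_cat map_nseq /= sumn_nseq mulSn mulnC.
by rewrite addnA.
Qed.

Lemma mem_with_largest N O n s :
  reflect (exists k b t, [/\ s = block N k b ++ t, k.+1 * N <= n, k < n &
             t \in O (n - k.+1 * N)])
          (s \in with_largest N O n).
Proof.
apply: (iffP allpairsPdep) => [[p [t [/allpairsP[[k b] [/= kn _ ->]] tO ->]]]|].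
  move: kn; rewrite mem_filter mem_iota add0n /= => /andP[kN kn].
  by exists k, b, t.
move=> [k [b [t [-> kN kn tO]]]]; exists (k, b), t; split=> //.
apply/allpairsP; exists (k, b); split=> //=; last by case: b.
by rewrite mem_filter kN mem_iota.
Qed.

(** Induction on the largest allowed size: an overpartition containing it starts with it, and
    [path_blockP] splits off its block. *)
Lemma mem_overpartitions N n s : (s \in overpartitions N n) =
  is_overpartition n s && all (fun x => x.1 <= N) s.
Proof.
elim: N n s => [|N IH] n s /=.
  case: s => [|x s]; rewrite /is_overpartition /=.
    by case: n.
  by case: n => [|n]; case: (x.1) => [|m] //=; rewrite !(andbF, andFb).
rewrite mem_cat IH; apply/orP/idP => [[|/mem_with_largest]|].
- by move=> /andP[-> sN]; apply: sub_all sN => x /leq_trans; apply.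
- move=> [k [b [t [-> kn _]]]]; rewrite IH => /andP[/and3P[st t0 /eqP tn] tN].
  have tN1 : all (fun x => x.1 < N.+1) t by apply: sub_all tN.
  apply/andP; split; last first.
    rewrite /= all_cat leqnn all_nseq /= leqnn orbT /=.
    by apply: sub_all tN => x /leqW.
  apply/and3P; split.
  + by rewrite /=; apply/path_blockP; exists k, t.
  + by rewrite /= all_cat all_nseq /= orbT.
  + by rewrite sumn_unzip1_block tn subnKC.
move=> /andP[/and3P[ss s0 /eqP sn] sN].
have [sN'|] := boolP (all (fun x => x.1 <= N) s).
  by left; rewrite andbT; apply/and3P; split=> //; apply/eqP.
move=> sNN; right.
case: s ss s0 sn sN sNN => [//|[M b] s] /= ps /andP[M0 s0] sn /andP[MN sN] sN'.
have EM : M = N.+1.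
  apply/eqP; rewrite eqn_leq MN ltnNge; apply: contra sN' => MN'; rewrite MN' /=.
  apply: sub_all (order_path_min may_follow_trans ps) => x /may_follow_le /= xM.
  exact: leq_trans xM MN'.
rewrite {}EM in ps sn *.
have /path_blockP[k [t [Es tN st]]] := ps.
have sumE : k.+1 * N.+1 + sumn (unzip1 t) = n.
  by rewrite -(sumn_unzip1_block _ _ b) -sn Es.
apply/mem_with_largest; exists k, b, t; split=> //; first by rewrite /block Es.
- by rewrite -sumE leq_addr.
- by rewrite -sumE; lia.
rewrite IH; apply/andP; split; last by apply: sub_all tN.
apply/and3P; split=> //; last by rewrite -sumE addKn.
by move: s0; rewrite Es all_cat => /andP[].
Qed.

(** The head of the list determines [b], and counting plain copies of the largest size determines
    [k], so each list arises once. *)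
Lemma uniq_overpartitions N n : uniq (overpartitions N n).
Proof.
elim: N n => [|N IH] n /=; first by case: n.
rewrite cat_uniq IH /=; apply/andP; split.
  apply/hasPn => s /mem_with_largest[k [b [t [-> _ _ _]]]].
  by rewrite mem_overpartitions /= ltnn /= andbF.
apply: allpairs_uniq_dep => //.
- apply: allpairs_uniq => //; first by rewrite filter_uniq // iota_uniq.
  by move=> [? ?] [? ?] _ _ [-> ->].
move=> u v /allpairsPdep[[k b] [t [_ tO ->]]] /allpairsPdep[[k' b'] [t' [_ tO' ->]]] /=.
have count0 m r : r \in overpartitions N m -> count_mem (N.+1, false) r = 0.
  rewrite mem_overpartitions => /andP[_ rN]; apply/count_memPn.
  by apply/negP => /(allP rN) /=; rewrite ltnn.
case=> -> E.
have Ek : k = k'.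
  have := congr1 (count_mem (N.+1, false)) E.
  rewrite !count_cat !count_nseq /= eqxx.
  by rewrite (count0 _ _ tO) (count0 _ _ tO') !mul1n !addn0.
move: E; rewrite {}Ek => /eqP; rewrite eqseq_cat // eqxx /= => /eqP Et.
by rewrite Et.
Qed.

Lemma leq_sumn_mem (s : seq nat) x : x \in s -> x <= sumn s.
Proof.
elim: s => //= y s IH; rewrite inE => /predU1P[->|/IH xs]; first exact: leq_addr.
exact: leq_trans xs (leq_addl _ _).
Qed.

Lemma overpartition_le n s x : is_overpartition n s -> x \in s -> x.1 <= n.
Proof. by move=> /and3P[_ _ /eqP <-] xs; apply: leq_sumn_mem; exact: map_f. Qed.

Lemma overpartition_size n s : is_overpartition n s -> size s <= n.
Proof.
move=> /and3P[_ s0 /eqP <-]; elim: s s0 => //= x s IH /andP[x0 /IH].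
by move=> ss; rewrite -add1n leq_add.
Qed.

Lemma largest_part_cons x s : largest_part (x :: s) = maxn x.1 (largest_part s).
Proof. by rewrite /largest_part big_cons. Qed.

Lemma largest_part_le N s : (largest_part s <= N) = all (fun x => x.1 <= N) s.
Proof.
elim: s => [|x s IH]; first by rewrite /largest_part big_nil.
by rewrite largest_part_cons geq_max IH.
Qed.

(** Forgetting the bounds on length and size is a bijection onto the listed overpartitions that
    satisfy the same conditions. *)
Lemma Pbar_count j n m : Pbar j n m =
  count (fun s => (j <= largest_part s) && (missing_from j s == m)) (overpartitions n n).
Proof.
pose erase (s : n.-bseq ('I_n.+1 * bool)) := [seq (nat_of_ord x.1, x.2) | x <- s].
have erase_inj : injective erase.
  move=> s t /inj_map st; apply: val_inj; apply: st => -[x b] [y c] /= [/val_inj -> ->].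
  by [].
rewrite /Pbar cardE -(size_map erase) -size_filter; apply/perm_size/uniq_perm.
- by rewrite map_inj_uniq // enum_uniq.
- by rewrite filter_uniq // uniq_overpartitions.
move=> s; rewrite mem_filter mem_overpartitions; apply/mapP/idP => [[t]|].
  rewrite mem_enum => /and3P[ot jt mt] ->; rewrite -/(erase _) in ot jt mt *.
  rewrite jt mt ot /=; apply/allP => x; exact: overpartition_le.
move=> /andP[/andP[js ms] /andP[os _]].
have sz : size [seq (inord x.1 : 'I_n.+1, x.2) | x <- s] <= n.
  by rewrite size_map; exact: overpartition_size.
have Es : erase (Bseq sz) = s.
  rewrite /erase /= -map_comp -[RHS]map_id; apply/eq_in_map => -[x b] xs /=.
  by rewrite inordK // ltnS; exact: (overpartition_le os xs).
exists (Bseq sz); last by rewrite Es.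
by rewrite mem_enum inE; apply/and3P; rewrite -/(erase _) Es.
Qed.

End Enumeration.

(** * Overpartitions weighted by their missing sizes *)

Section WeightedCounts.
Context {K : comNzRingType}.
Variables (w : K) (j : nat).
Implicit Types (s t : seq (nat * bool)).

Definition missing_in s (r : seq nat) := count (fun i => i \notin unzip1 s) r.

(** The range ends at [N] whatever the largest part is, so each size up to [N] contributes
    independently of the others. *)
Definition weighted_count N n : K :=
  \sum_(s <- overpartitions N n) w ^+ missing_in s (index_iota j N.+1).

(* The largest part is [N.+1], with multiplicity [k.+1]; only half of these
   overpartitions are counted, since that part may be overlined or not. *)
Definition weighted_top N n : K :=
  \sum_(0 <= k < n.+1)
    if (k.+1 * N.+1 <= n)%N then weighted_count N (n - k.+1 * N.+1)%N else 0.

Lemma sum_with_largest N O n (F : seq (nat * bool) -> K) : (0 < N)%N ->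
  \sum_(s <- with_largest N O n) F s =
  \sum_(0 <= k < n.+1) if (k.+1 * N <= n)%N then
    \sum_(t <- O (n - k.+1 * N)%N)
      (F (block N k true ++ t) + F (block N k false ++ t)) else 0.
Proof.
move=> N0; rewrite /with_largest big_allpairs_dep big_allpairs_dep big_filter /=.
(* The index [k = n] only makes the range uniform: [n.+1 * N] exceeds [n], so its term is zero. *)
rewrite big_nat_recr //= (_ : (n.+1 * N <= n)%N = false) ?addr0; last first.
  by apply/negbTE; rewrite -ltnNge; exact: leq_pmulr.
rewrite -big_mkcond /index_iota subn0; apply: eq_bigr => k _.
by rewrite big_cons big_seq1 big_split.
Qed.

Lemma unzip1_block N k b t i :
  (i \in unzip1 (block N k b ++ t)) = (i == N) || (i \in unzip1 t).
Proof.
rewrite /= inE /unzip1 map_cat mem_cat map_nseq mem_nseq /= .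
by case: (i == N); rewrite ?andbF.
Qed.

Lemma missing_in_iota_recr s N : (j <= N.+1)%N ->
  missing_in s (index_iota j N.+2) =
  (missing_in s (index_iota j N.+1) + (N.+1 \notin unzip1 s))%N.
Proof.
move=> jN; rewrite /index_iota subSn // /missing_in -addn1 iotaD count_cat /=.
by rewrite subnKC // addn0.
Qed.

Lemma missing_in_block N k b t r : all (fun i => i < N)%N r ->
  missing_in (block N k b ++ t) r = missing_in t r.
Proof.
move=> /allP rN; apply: eq_in_count => i /rN iN.
by rewrite unzip1_block ltn_eqF.
Qed.

Lemma all_index_iota_lt m n : all (fun i => i < n)%N (index_iota m n).
Proof. by apply/allP => i; rewrite mem_index_iota => /andP[]. Qed.

Lemma index_iota_nil m n : (n <= m)%N -> index_iota m n = [::].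
Proof. by rewrite /index_iota -subn_eq0 => /eqP ->. Qed.

Lemma missing_in_top N k b t :
  missing_in (block N.+1 k b ++ t) (index_iota j N.+2) =
  missing_in t (index_iota j N.+1).
Proof.
have [jN|Nj] := leqP j N.+1.
  rewrite missing_in_iota_recr // missing_in_block ?all_index_iota_lt //.
  by rewrite unzip1_block eqxx addn0.
by rewrite !index_iota_nil // ltnW.
Qed.

Lemma weighted_count0 n : (0 < j)%N -> weighted_count 0 n = (n == 0)%:R.
Proof.
move=> j0; rewrite /weighted_count /=; case: n => [|n]; last by rewrite big_nil.
by rewrite big_seq1 index_iota_nil.
Qed.

(** Either the size [N.+1] is absent, which costs a factor [w] if it is at least [j], or it occurs
    and its first copy may be overlined, whence the 2. *)
Lemma weighted_countS N n : weighted_count N.+1 n =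
  (if (j <= N.+1)%N then w else 1) * weighted_count N n + 2 * weighted_top N n.
Proof.
rewrite /weighted_count /= big_cat /=; congr (_ + _).
  rewrite mulr_sumr big_seq [RHS]big_seq; apply: eq_bigr => s.
  rewrite mem_overpartitions => /andP[_ sN].
  have [jN|Nj] := leqP j N.+1.
    rewrite missing_in_iota_recr // (_ : N.+1 \notin _) ?addn1 ?exprS //.
    by apply/mapP => -[x /(allP sN)] /= xN EN; move: xN; rewrite -EN ltnn.
  by rewrite mul1r !index_iota_nil // ltnW.
rewrite sum_with_largest // /weighted_top mulr_sumr; apply: eq_bigr => k _.
case: ifP => _; last by rewrite mulr0.
rewrite /weighted_count mulr_sumr; apply: eq_bigr => t _.
by rewrite !missing_in_top mulrDl mul1r.
Qed.

Lemma largest_part_block N k b t : all (fun x => x.1 <= N)%N t ->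
  largest_part (block N k b ++ t) = N.
Proof.
move=> tN; apply/eqP; rewrite eqn_leq largest_part_le /block /= leqnn all_cat tN.
by rewrite all_nseq /= leqnn orbT largest_part_cons leq_maxl.
Qed.

(** Each summand collects the overpartitions with largest part [M.+1]; the sizes that can be missing
    then run from [j] to [M], as in [weighted_count]. Positive [n] excludes the empty
    overpartition. *)
Lemma sum_overpartitions_largest N n : (0 < n)%N ->
  \sum_(s <- overpartitions N n | (j <= largest_part s)%N) w ^+ missing_from j s =
  \sum_(0 <= M < N) if (j <= M.+1)%N then 2 * weighted_top M n else 0.
Proof.
move=> n0; elim: N => [|N IH]; first by rewrite /= (gtn_eqF n0) big_nil big_geq.
rewrite /= big_cat /= IH big_nat_recr //=; congr (_ + _).
rewrite big_mkcond sum_with_largest // /weighted_top.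
have [jN|Nj] := leqP j N.+1; last first.
  rewrite big1 // => k _; case: ifP => // _; rewrite big_seq big1 // => t.
  rewrite mem_overpartitions => /andP[_ tN].
  have tN1 : all (fun x => x.1 <= N.+1)%N t by apply: sub_all tN => x /leqW.
  by rewrite !largest_part_block // leqNgt Nj addr0.
rewrite mulr_sumr; apply: eq_bigr => k _; case: ifP => _; last by rewrite mulr0.
rewrite /weighted_count mulr_sumr big_seq [RHS]big_seq; apply: eq_bigr => t.
rewrite mem_overpartitions => /andP[_ tN].
have tN1 : all (fun x => x.1 <= N.+1)%N t by apply: sub_all tN => x /leqW.
rewrite /missing_from !largest_part_block // jN.
by rewrite -!/(missing_in _ _) !missing_in_block ?all_index_iota_lt // mulrDl mul1r.
Qed.

(** At most [n] sizes are missing, so for [M] above [n] each overpartition is met at exactly one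
    [m]. *)
Lemma sum_Pbar n M : (0 < n < M)%N ->
  \sum_(0 <= m < M) (Pbar j n m)%:R * w ^+ m =
  \sum_(0 <= N < n) if (j <= N.+1)%N then 2 * weighted_top N n else 0.
Proof.
move=> /andP[n0 nM]; rewrite -sum_overpartitions_largest //.
pose F m s := if missing_from j s == m then w ^+ m else 0.
transitivity (\sum_(0 <= m < M)
    \sum_(s <- overpartitions n n | (j <= largest_part s)%N) F m s).
  apply: eq_bigr => m _; rewrite Pbar_count -sum1_count natr_sum mulr_suml.
  by rewrite big_mkcondr; apply: eq_bigr => s _; rewrite /F; case: ifP; rewrite ?mul1r.
rewrite exchange_big /= big_seq_cond [RHS]big_seq_cond; apply: eq_bigr => s.
rewrite mem_overpartitions => /andP[/andP[_ sn] _].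
rewrite /F -big_mkcond; under eq_bigl do rewrite eq_sym.
rewrite big_nat1_eq /= ifT //.
apply: leq_ltn_trans nM; apply: leq_trans (count_size _ _) _.
rewrite size_iota (leq_trans (leq_subr _ _)) //.
by rewrite largest_part_le.
Qed.

End WeightedCounts.

(** * Generating functions *)

Section GeneratingFunction.
Context {R : realType}.
Local Notation C := R[i].
Implicit Types (u : nat -> C) (q w : C).

Lemma abs_sums_behead u s a : abs_sums u s a -> u 0 = 0 ->
  abs_sums (fun n => u n.+1) s a.
Proof.
move=> [/cvg_seq_dist us ua] u0.
have E (V : nmodType) (f : C -> V) n : f 0 = 0 ->
    \sum_(0 <= i < n) f (u i.+1) = \sum_(0 <= i < n.+1) f (u i).
  by move=> f0; rewrite [RHS]big_nat_recl //= u0 f0 add0r.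
split=> [|n]; last by rewrite (E _ (fun x => `|x|)) ?normr0.
apply/cvg_seq_dist => e /us[N HN]; exists N => n Nn.
by rewrite /series /= (E _ id) //; exact: HN (leqW Nn).
Qed.

Lemma abs_sums_drop d u s a : abs_sums u s a ->
  abs_sums (fun n => if (d <= n)%N then u n else 0) (s - \sum_(l < d) u l) a.
Proof.
move=> [us ua]; split=> [|n]; last first.
  apply: le_trans (ua n); apply: ler_sum => i _.
  by case: ifP => // _; rewrite normr0.
apply: (cvg_seq_near (N := d) (cvg_seqB us (cvg_seq_cst (\sum_(l < d) u l)))) => n dn.
rewrite /series /= (big_cat_nat (leq0n d) dn) /= big_mkord addrAC subrr add0r.
rewrite [RHS](big_cat_nat (leq0n d) dn) /= [X in _ = X + _]big_nat.
rewrite [X in _ = X + _]big1 ?add0r; last by move=> i /andP[_ id]; rewrite leqNgt id.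
by rewrite big_nat [RHS]big_nat; apply: eq_bigr => i /andP[-> _].
Qed.

(** A size below the largest part is absent, with weight [w] or 1, or occurs in two ways with any
    positive multiplicity: 2 (x + x^2 + ...) at x = q^i. *)
Definition part_factor j i w q : C :=
  (if (j <= i)%N then w else 1) + 2 * (q ^+ i / (1 - q ^+ i)).

Definition count_gf j N w q : C := \prod_(i < N) part_factor j i.+1 w q.

Lemma norm_exprS_lt1 q i : `|q| < 1 -> `|q ^+ i.+1| < 1.
Proof. by move=> q1; rewrite exprS norm_mul_lt1 // norm_expr_le1. Qed.

(** Multiplicity [k.+1] of the top part shifts the coefficients by [k.+1 * N.+1]; the sum over [k]
    is geometric with ratio [q ^+ N.+1]. *)
Lemma weighted_top_sums w j q N s a : `|q| < 1 ->
  abs_sums (fun n => weighted_count w j N n * q ^+ n) s a ->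
  abs_sums (fun n => weighted_top w j N n * q ^+ n)
    (q ^+ N.+1 / (1 - q ^+ N.+1) * s)
    (`|q| ^+ N.+1 / (1 - `|q| ^+ N.+1) * a).
Proof.
move=> q1 us; pose x := q ^+ N.+1.
have x1 : `|x| < 1 by exact: norm_exprS_lt1.
pose f k n := if (k.+1 * N.+1 <= n)%N then
  weighted_count w j N (n - k.+1 * N.+1)%N * q ^+ n else 0.
have fs k : abs_sums (f k) (x * s * x ^+ k) (`|x| * a * `|x| ^+ k).
  have -> : x * s * x ^+ k = x ^+ k.+1 * s by rewrite exprS; ring.
  have -> : `|x| * a * `|x| ^+ k = `|x ^+ k.+1| * a
    by rewrite [`|x ^+ k.+1|]normrX [X in _ = X * _]exprS mulrAC.
  apply: (abs_sums_ext _ (abs_sumsZ _ (abs_sums_shift (k.+1 * N.+1)%N us))) => n.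
  rewrite /f; case: ifP => [kn|_]; last by rewrite mulr0.
  by rewrite mulrCA /x -exprM [(N.+1 * _)%N]mulnC -exprD subnKC.
have f0 k n : (n < k)%N -> f k n = 0.
  move=> nk; rewrite /f ifN // -ltnNge (leq_trans nk) //.
  by rewrite (leq_trans (leqnSn k)) // leq_pmulr.
have a0 := abs_sums_bound_ge0 us.
have geo := abs_sumsZ (x * s) (abs_sums_geometric x1).
have bound n : \sum_(0 <= k < n) `|x| * a * `|x| ^+ k <= `|x| * a / (1 - `|x|).
  by rewrite -mulr_sumr ler_wpM2l ?mulr_ge0 // geometric_sum_le.
rewrite -normrX -/x mulrAC [X in abs_sums _ _ X]mulrAC.
apply: (abs_sums_ext _ (abs_sums_triangular fs f0 geo.1 bound)) => n.
rewrite /weighted_top mulr_suml; apply: eq_bigr => k _.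
by rewrite /f; case: ifP; rewrite ?mul0r.
Qed.

(** Apart from [w], the recurrence has nonnegative coefficients, so the same product at [|w|] and
    [|q|] is a bound. *)
Lemma weighted_count_sums w j q N : (0 < j)%N -> `|q| < 1 ->
  abs_sums (fun n => weighted_count w j N n * q ^+ n)
    (count_gf j N w q) (count_gf j N `|w| `|q|).
Proof.
move=> j0 q1; elim: N => [|N IH].
  rewrite /count_gf !big_ord0.
  apply: (abs_sums_ext _ (abs_sums_delta (K := C))) => n.
  rewrite weighted_count0 //; case: n => [|n]; first by rewrite expr0 mulr1.
  by rewrite mul0r.
rewrite /count_gf !big_ord_recr /= -!/(count_gf _ _ _ _).
have -> : count_gf j N w q * part_factor j N.+1 w q =
    (if (j <= N.+1)%N then w else 1) * count_gf j N w q +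
    2 * (q ^+ N.+1 / (1 - q ^+ N.+1) * count_gf j N w q).
  by rewrite /part_factor mulrDr !(mulrC (count_gf _ _ _ _)) !mulrA.
have -> : count_gf j N `|w| `|q| * part_factor j N.+1 `|w| `|q| =
    `|if (j <= N.+1)%N then w else 1| * count_gf j N `|w| `|q| +
    `|2| * (`|q| ^+ N.+1 / (1 - `|q| ^+ N.+1) * count_gf j N `|w| `|q|).
  rewrite /part_factor (fun_if Num.norm) normr1 [`|2|]ger0_norm //.
  by rewrite mulrDr !(mulrC (count_gf _ _ _ _)) !mulrA.
apply: (abs_sums_ext _ (abs_sumsD (abs_sumsZ _ IH)
  (abs_sumsZ 2 (weighted_top_sums q1 IH)))) => n.
by rewrite weighted_countS [RHS]mulrDl !mulrA.
Qed.

(** The series of the overpartitions with largest part [N.+1]. *)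
Definition top_gf j N w q : C := 2 * (q ^+ N.+1 / (1 - q ^+ N.+1) * count_gf j N w q).

(** For sizes below [j] the factor is 1 + 2x/(1 - x) = (1 + x)/(1 - x). *)
Lemma count_gf_small j N w q : (N < j)%N -> `|q| < 1 ->
  count_gf j N w q * qpoch q q N = qpoch (- q) q N.
Proof.
move=> Nj q1; rewrite /count_gf /qpoch -big_split; apply: eq_bigr => i _ /=.
rewrite /part_factor ifN; last by rewrite -ltnNge (leq_ltn_trans _ Nj).
have := one_subX_neq0 q1 i; rewrite exprS => h; field; exact: h.
Qed.

(** Sizes from [j] on contribute w (1 - a q^i)/(1 - q^i) with a = (w - 2)/w; the factor (a;q)_j on
    the left supplies the first [j] factors of (a;q)_{j+m}. The induction starts where only sizes
    below [j] occur. *)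
Lemma count_gf_qpoch j m w q : (0 < j)%N -> w != 0 -> `|q| < 1 ->
  count_gf j (j.-1 + m)%N w q * qpoch q q (j.-1 + m)%N * qpoch ((w - 2) / w) q j =
  w ^+ m * qpoch (- q) q j.-1 * qpoch ((w - 2) / w) q (j + m)%N.
Proof.
move=> j0 w0 q1; elim: m => [|m IH].
  by rewrite !addn0 expr0 mul1r count_gf_small // prednK.
rewrite !addnS /count_gf big_ord_recr /= -/(count_gf _ _ _ _) !qpochS.
have jm : ((j.-1 + m).+1 = j + m)%N by rewrite -addSn prednK.
rewrite /part_factor jm leq_addr -exprS jm.
have h : 1 - q ^+ (j + m)%N != 0 by rewrite -jm one_subX_neq0.
set a := (w - 2) / w in IH *.
transitivity (count_gf j (j.-1 + m)%N w q * qpoch q q (j.-1 + m)%N * qpoch a q j *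
    (w * (1 - a * q ^+ (j + m)%N))).
  by rewrite /a; field; rewrite h w0.
by rewrite IH exprS; ring.
Qed.

Definition top_constant j w q : C :=
  2 * w ^- j * qpoch (- q) q j.-1 / qpoch ((w - 2) / w) q j.

(** The denominator 1 - q^{j+m} of the top part completes (q;q)_{j+m-1} to (q;q)_{j+m}, and w^m
    q^{j+m} = w^{-j} (wq)^{j+m}. *)
Lemma top_gf_qbinomial j m w q : (0 < j)%N -> w != 0 -> `|q| < 1 ->
  qpoch ((w - 2) / w) q j != 0 ->
  top_gf j (j.-1 + m)%N w q =
  top_constant j w q * qbinomial_term ((w - 2) / w) q (w * q) (j + m)%N.
Proof.
move=> j0 w0 q1 aj0.
have := count_gf_qpoch m j0 w0 q1.
rewrite /top_gf /top_constant /qbinomial_term.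
have jm : ((j.-1 + m).+1 = j + m)%N by rewrite -addSn prednK.
have -> : qpoch q q (j + m)%N = qpoch q q (j.-1 + m)%N * (1 - q ^+ (j + m)%N).
  by rewrite -jm qpochS -exprS.
rewrite jm => E.
have h : 1 - q ^+ (j + m)%N != 0 by rewrite -jm one_subX_neq0.
have h2 := qpoch_neq0 (j.-1 + m)%N q1 q1.
have -> : count_gf j (j.-1 + m)%N w q = w ^+ m * qpoch (- q) q j.-1 *
    qpoch ((w - 2) / w) q (j + m)%N / qpoch q q (j.-1 + m)%N / qpoch ((w - 2) / w) q j.
  by rewrite -E; field; rewrite h2 aj0.
rewrite exprMn [w ^+ (j + m)%N]exprD.
have wj : w ^+ j != 0 by rewrite expf_neq0.
by field; rewrite h h2 aj0 wj.
Qed.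

Lemma top_gf_sums j w q : (0 < j)%N -> w != 0 -> `|q| < 1 -> `|w * q| < 1 ->
  qpoch ((w - 2) / w) q j != 0 ->
  exists B, abs_sums (fun N => if (j <= N.+1)%N then top_gf j N w q else 0)
    (top_constant j w q *
      (qpoch_inf ((w - 2) * q) q / qpoch_inf (w * q) q -
       \sum_(l < j) qbinomial_term ((w - 2) / w) q (w * q) l)) B.
Proof.
move=> j0 w0 q1 wq1 aj0.
have [B HB] := qbinomial q1 ((w - 2) / w) wq1.
exists (`|top_constant j w q| * B).
rewrite (_ : (w - 2) / w * (w * q) = (w - 2) * q) in HB; last by field.
have h0 : (fun n => if (j <= n)%N then
    qbinomial_term ((w - 2) / w) q (w * q) n else 0) 0 = 0 by rewrite leqNgt j0.
apply: (abs_sums_ext _ (abs_sumsZ _ (abs_sums_behead (abs_sums_drop j HB) h0))) => N /=.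
case: ifP => jN; last by rewrite mulr0.
have EN : N.+1 = (j + (N.+1 - j))%N by rewrite subnKC.
have EN' : N = (j.-1 + (N.+1 - j))%N.
  by apply: succn_inj; rewrite -addSn prednK.
by rewrite [in RHS]EN' top_gf_qbinomial // -EN.
Qed.

(* Lets the sums at [`|w|], [`|q|] serve as majorants: there [a = (w - 2) / w]
   satisfies [w (1 - a q^i) = w (1 - q^i) + 2 q^i > 0]. *)
Lemma qpoch_pos_neq0 j w q : 0 < w -> 0 <= q -> q < 1 ->
  qpoch ((w - 2) / w) q j != 0.
Proof.
move=> w0 q0 q1; apply/prodf_neq0 => i _.
have x0 : 0 <= q ^+ i by rewrite exprn_ge0.
have x1 : q ^+ i <= 1 by rewrite exprn_ile1 // ltW.
have w0' : w != 0 by rewrite gt_eqF.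
have -> : 1 - (w - 2) / w * q ^+ i = (w * (1 - q ^+ i) + 2 * q ^+ i) / w by field.
rewrite mulf_neq0 ?invr_eq0 // gt_eqF //.
have [->|xn0] := eqVneq (q ^+ i) 0; first by rewrite subr0 mulr0 addr0 mulr1.
rewrite ltr_wpDl ?mulr_ge0 ?subr_ge0 ?(ltW w0) //.
by rewrite mulr_gt0 // lt_def xn0.
Qed.

Lemma weighted_top_eq0 w j N n : (n <= N)%N -> weighted_top w j N n = 0.
Proof.
move=> nN; rewrite /weighted_top big1 // => k _; rewrite ifN //.
by rewrite -ltnNge (leq_ltn_trans nN) // leq_pmull.
Qed.

Lemma overpartition_gf j w q : (0 < j)%N -> w != 0 -> `|q| < 1 -> `|w * q| < 1 ->
  qpoch ((w - 2) / w) q j != 0 ->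
  exists B, abs_sums (fun n => (\sum_(0 <= N < n)
      if (j <= N.+1)%N then 2 * weighted_top w j N n else 0) * q ^+ n)
    (top_constant j w q *
      (qpoch_inf ((w - 2) * q) q / qpoch_inf (w * q) q -
       \sum_(l < j) qbinomial_term ((w - 2) / w) q (w * q) l)) B.
Proof.
move=> j0 w0 q1 wq1 aj0.
pose f N n := if (j <= N.+1)%N then 2 * (weighted_top w j N n * q ^+ n) else 0.
pose a N := if (j <= N.+1)%N then top_gf j N `|w| `|q| else 0.
have fs N : abs_sums (f N) (if (j <= N.+1)%N then top_gf j N w q else 0) (a N).
  rewrite /f /a; case: ifP => _; last exact: abs_sums0.
  have := abs_sumsZ 2 (weighted_top_sums q1 (weighted_count_sums w N j0 q1)).
  by rewrite [`|2|]ger0_norm.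
have f0 N n : (n < N)%N -> f N n = 0.
  by move=> nN; rewrite /f weighted_top_eq0 ?(ltnW nN) // mul0r mulr0 if_same.
have [B0 S0] := top_gf_sums j0 w0 q1 wq1 aj0.
(* The row bounds are terms of the same series at [|w|] and [|q|], so the closed form applied there
   makes them summable. *)
have [||||B S1] := @top_gf_sums j `|w| `|q| j0.
- by rewrite normr_eq0.
- by rewrite normr_id.
- by rewrite -normrM normr_id.
- by rewrite qpoch_pos_neq0 // normr_gt0.
have aB n : \sum_(0 <= N < n) a N <= B.
  apply: le_trans (S1.2 n); apply: ler_sum => N _.
  by rewrite -/(a N) ger0_norm //; exact: abs_sums_bound_ge0 (fs N).
exists B; apply: (abs_sums_ext _ (abs_sums_triangular fs f0 S0.1 aB)) => n.
(* The triangular sum includes [N = n], where the largest part would exceed [n]; that term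
   vanishes. *)
rewrite big_nat_recr //= {2}/f weighted_top_eq0 // mul0r mulr0 if_same addr0.
rewrite mulr_suml; apply: eq_bigr => N _; rewrite /f.
by case: ifP; rewrite ?mul0r ?mulrA.
Qed.

End GeneratingFunction.

Theorem theorem3p1 (R : realType) (j : nat) (q w : R[i])
    (hj : (0 < j)%N) (hq : `|q| < 1) (hwq : `|w * q| < 1)
    (hw : w != 0) (hden : qpoch ((w - 2) / w) q j != 0) :
  is_double_series
    (fun n m => (Pbar j n.+1 m)%:R * w ^+ m * q ^+ n.+1)
    (2 * w ^- j * qpoch (- q) q j.-1 / qpoch ((w - 2) / w) q j *
     (qpoch_inf ((w - 2) * q) q / qpoch_inf (w * q) q -
      \sum_(l < j) qpoch ((w - 2) / w) q l / qpoch q q l * (w * q) ^+ l)).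
Proof.
have [B HB] := overpartition_gf hj hw hq hwq hden.
(* The term at n = 0 is an empty sum, so the series may start at n = 1. *)
have h0 : (\sum_(0 <= N < 0)
    if (j <= N.+1)%N then 2 * weighted_top w j N 0 else 0) * q ^+ 0 = 0.
  by rewrite big_geq // mul0r.
have [[outer] _] := abs_sums_behead HB h0.
pose v n := (\sum_(0 <= N < n.+1)
  if (j <= N.+1)%N then 2 * weighted_top w j N n.+1 else 0) * q ^+ n.+1.
exists v => [n|]; last exact: outer.
suff [] : series (fun m => (Pbar j n.+1 m)%:R * w ^+ m * q ^+ n.+1) ~> v n by [].
(* The inner series is eventually constant: [sum_Pbar] applies as soon as [M] exceeds [n.+1]. *)
apply: (cvg_seq_near (N := n.+2) (cvg_seq_cst _)) => M nM.
by rewrite /v /series /= -mulr_suml sum_Pbar.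
Qed.
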